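(* The Szegő kernel for the Hardy space $\mathcal H=H^2(\mathbb D)$ on the unit disk $\mathbb D$ has the Invertible Multiplier Property.
   Context: $H^2(\mathbb D)$ is normed by $\|f\|^2=\frac1{2\pi}\int_0^{2\pi}|f(e^{it})|^2dt$ (boundary values), so $\|1\|=1$; its normalized reproducing kernels are $\widetilde{k_a}(z)=\sqrt{1-|a|^2}/(1-\overline az)$, $a\in\mathbb D$. Invertible Multiplier Property for a Hilbert function space $\mathcal H$ on $\Omega$ with normalized reproducing kernels $\widetilde{k_a}$: for every $M\ge1$, $\mathbf a=(a_1,\dots,a_M)\in\Omega^M$ and nonnegative $\theta_0,\dots,\theta_M$ with $\sum_{m=0}^M\theta_m=1$, there is a normalized invertible multiplier $\psi$ of $\mathcal H$ (i.e. $\psi$ is nonvanishing, multiplication by $\psi$ and by $1/\psi$ map $\mathcal H$ to $\mathcal H$, and $\|\psi\|_{\mathcal H}=1$) such that $$\theta_0\langle f,g\rangle_{\mathcal H}+\sum_{m=1}^M\theta_m\langle\widetilde{k_{a_m}}f,\widetilde{k_{a_m}}g\rangle_{\mathcal H}=\langle\psi f,\psi g\rangle_{\mathcal H},\qquad f,g\in\mathcal H.$$ *)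

(* Defs.v *)
From HB Require Import structures.
From mathcomp Require Import all_boot all_order all_algebra.
From mathcomp Require Import complex.
From mathcomp Require Import all_classical all_reals all_analysis.

Set Implicit Arguments.
Unset Strict Implicit.
Unset Printing Implicit Defensive.

Import Order.TTheory GRing.Theory Num.Theory.
Import numFieldNormedType.Exports.

Local Open Scope classical_set_scope.
Local Open Scope ring_scope.
Local Open Scope complex_scope.

(* A function space on [Omega] is given by a membership predicate [H] and an
   inner product [ip] (linear in the first argument); functions are total on
   the ambient type [T], and only their values on [Omega] are meaningful. *)

Definition is_multiplier (R : realType) (T : Type) (H : set (T -> R[i]))
    (psi : T -> R[i]) : Prop :=
  forall f, H f -> H (fun z => psi z * f z).

Definition ip_norm (R : realType) (T : Type)
    (ip : (T -> R[i]) -> (T -> R[i]) -> R[i]) (f : T -> R[i]) : R :=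
  Num.sqrt (complex.Re (ip f f)).

Definition normalized_invertible_multiplier (R : realType) (T : Type)
    (Omega : set T) (H : set (T -> R[i]))
    (ip : (T -> R[i]) -> (T -> R[i]) -> R[i]) (psi : T -> R[i]) : Prop :=
  [/\ forall z, Omega z -> psi z != 0,
      is_multiplier H psi,
      is_multiplier H (fun z => (psi z)^-1),
      H psi
    & ip_norm ip psi = 1].

(* [nk a] is the normalized reproducing kernel at [a].  The weights
   theta_0, ..., theta_M are indexed by 'I_M.+1; the weight of [a m] is
   [theta (lift ord0 m)], since 'I_M is zero-based. *)
Definition invertible_multiplier_property (R : realType) (T : Type)
    (Omega : set T) (H : set (T -> R[i]))
    (ip : (T -> R[i]) -> (T -> R[i]) -> R[i])
    (nk : T -> T -> R[i]) : Prop :=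
  forall (M : nat) (a : 'I_M -> T) (theta : 'I_M.+1 -> R),
    (1 <= M)%N ->
    (forall m, Omega (a m)) ->
    (forall m, 0 <= theta m) ->
    \sum_(m < M.+1) theta m = 1 ->
    exists psi : T -> R[i],
      normalized_invertible_multiplier Omega H ip psi /\
      forall f g, H f -> H g ->
        (theta ord0)%:C * ip f g
        + \sum_(m < M) (theta (lift ord0 m))%:C
            * ip (fun z => nk (a m) z * f z) (fun z => nk (a m) z * g z)
        = ip (fun z => psi z * f z) (fun z => psi z * g z).

Definition unit_disk (R : realType) : set R[i] := [set z | `|z| < 1].

(* [R[i]^o] carries the topology of the modulus and the structure of a normed
   space over [R[i]], so this is complex differentiability. *)
Definition holomorphic_on (R : realType) (D : set R[i]) (f : R[i] -> R[i]) :=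
  forall z, D z -> derivable (f : R[i]^o -> R[i]^o) z 1.

Definition cis (R : realType) (t : R) : R[i] := cos t +i* sin t.

Definition sqmod (R : realType) (z : R[i]) : R :=
  complex.Re z ^+ 2 + complex.Im z ^+ 2.

(* The mean over the circle is an extended real, so that the bound also says
   that it is finite. *)
Definition hardy2 (R : realType) : set (R[i] -> R[i]) :=
  [set f | holomorphic_on (@unit_disk R) f /\
    exists B : R, forall r : R, 0 <= r < 1 ->
      ((((2 * pi)^-1)%:E *
        \int[@lebesgue_measure R]_(t in `[0%R, (2 * pi)%R])
          (sqmod (f (r%:C * cis t)))%:E) <= B%:E)%E].

(* Radial limit of [f] at [cis t].  By Fatou's theorem it exists for almost
   every [t] when [f] is in [hardy2]; elsewhere [lim] takes the default
   value 0. *)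
Definition boundary_value (R : realType) (f : R[i] -> R[i]) (t : R) : R[i] :=
  lim ((f (r%:C * cis t) : R[i]^o) @[r --> (1 : R)^'-]).

Definition circle_mean (R : realType) (F : R -> R[i]) : R[i] :=
  ((2 * pi)^-1 * \int[@lebesgue_measure R]_(t in `[0, 2 * pi])
      complex.Re (F t))
  +i* ((2 * pi)^-1 * \int[@lebesgue_measure R]_(t in `[0, 2 * pi])
      complex.Im (F t)).

Definition hardy2_ip (R : realType) (f g : R[i] -> R[i]) : R[i] :=
  circle_mean (fun t => boundary_value f t * ((boundary_value g t)^*)%C).

Definition szego_normalized (R : realType) (a z : R[i]) : R[i] :=
  (Num.sqrt (1 - sqmod a))%:C / (1 - (a^*)%C * z).

(* Main.v *)
Require Import Defs.
From mathcomp Require Import all_boot all_order all_algebra.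
From mathcomp Require Import complex ring.
From mathcomp Require Import all_classical all_reals all_analysis.
From mathcomp Require Import measurable_realfun.

(* On the unit circle the weight theta_0 + sum_m theta_m |k_{a_m}|^2 is a
   positive trigonometric polynomial of degree at most M divided by
   prod_m |1 - a_m^* z|^2.  By the Fejer-Riesz theorem the numerator equals
   c |prod_i (1 - al_i^* z)|^2 with |al_i| < 1, so the weight is |psi|^2 with
   psi = sqrt c prod_i (1 - al_i^* z) / prod_m (1 - a_m^* z), which is
   holomorphic and bounded away from 0 and infinity on the closed disk.
   Boundary values satisfy (psi f)* = psi f* at every point of the circle, and
   the norm of psi is 1 because each normalized kernel has norm 1, by Poisson's
   integral. *)

Set Implicit Arguments.
Unset Strict Implicit.
Unset Printing Implicit Defensive.

Import Order.TTheory GRing.Theory Num.Theory.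
Import numFieldNormedType.Exports.

Local Open Scope classical_set_scope.
Local Open Scope ring_scope.

(** * Fejer-Riesz factorization on the unit circle *)

Section FejerRiesz.
Variable C : numClosedFieldType.
Implicit Types (z w al : C) (p q : {poly C}) (n : nat).

Lemma conj_unit_circle z : `|z| = 1 -> z^* = z^-1.
Proof. by move=> z1; rewrite invC_norm z1 expr1n invr1 mul1r. Qed.

(* The points (k + i) / (k - i), for [k] natural, are infinitely many. *)
Lemma poly_eq_on_circle p q :
  (forall z, `|z| = 1 -> p.[z] = q.[z]) -> p = q.
Proof.
move=> pq; apply/eqP; rewrite -subr_eq0; apply/eqP.
set r := p - q.
pose u (k : nat) : C := (k%:R + 'i) / (k%:R - 'i).
have ui k : k%:R - 'i != 0 :> C.
  rewrite subr_eq0; apply/eqP => /(congr1 (fun x : C => x ^+ 2)).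
  rewrite sqrCi => h; have : (0 : C) <= -1 by rewrite -h exprn_ge0 ?ler0n.
  by rewrite oppr_ge0 ler10.
have u1 k : `|u k| = 1.
  rewrite /u normf_div -(norm_conjC (k%:R - 'i)) rmorphB /= conjCi conjC_nat opprK.
  rewrite divff // normr_eq0.
  move: (ui k); rewrite -(conjC_eq0 (k%:R - 'i)) rmorphB /= conjCi conjC_nat opprK //.
have u_inj : injective u.
  move=> k l /eqP; rewrite /u eqr_div // => /eqP h.
  have /eqP : 2 * 'i * (l%:R - k%:R) = 0 :> C.
    rewrite -(subrr ((k%:R + 'i) * (l%:R - 'i))) {2}h; ring.
  rewrite !mulf_eq0 pnatr_eq0 (negPf (neq0Ci _)) /= subr_eq0 eqr_nat => /eqP ->//.
apply: (@roots_geq_poly_eq0 _ r [seq u k | k <- iota 0 (size r)]).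
- apply/allP => _ /mapP[k _ ->]; rewrite /root /r hornerD hornerN subr_eq0.
  by rewrite pq.
- by rewrite map_inj_uniq ?iota_uniq.
- by rewrite size_map size_iota.
Qed.

(** The conjugate-reciprocal polynomial of [q] for the formal degree [n]. It encodes reflection of
    the roots in the unit circle. *)
Definition reverse_conj n q : {poly C} := \poly_(i < n.+1) (q`_(n - i))^*.

Lemma horner_reverse_conj n q z : (size q <= n.+1)%N -> z != 0 ->
  (reverse_conj n q).[z] = z ^+ n * (q.[(z^*)^-1])^*.
Proof.
move=> sq z0; rewrite horner_poly (horner_coef_wide _ sq) rmorph_sum /= mulr_sumr.
rewrite (reindex_inj rev_ord_inj) /=; apply: eq_bigr => i _.
have ilen : (i <= n)%N by rewrite -ltnS.
have -> : (n - (n.+1 - i.+1) = i)%N by rewrite subSS subKn.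
have zi : z ^+ n = z ^+ (n.+1 - i.+1) * z ^+ i by rewrite subSS -exprD subnK.
rewrite rmorphM rmorphXn fmorphV /= conjCK mulrCA; congr (_ * _).
by rewrite zi exprVn mulfK // expf_neq0.
Qed.

(** Induction on the half-degree [n]. Real values on the circle make the roots of [q] symmetric
    under reflection in the circle, and positivity keeps them off it. Removing a root [al] with
    [|al| < 1] together with its mirror image [1 / al^*] splits off the factor [|1 - al^* z|^2],
    which is positive on the circle, so the quotient satisfies the same hypothesis. *)
Lemma fejer_riesz n q : (size q <= n.*2.+1)%N ->
  (forall z, `|z| = 1 -> 0 < q.[z] / z ^+ n) ->
  exists (c : C) (s : seq C),
    [/\ 0 < c, {in s, forall al, `|al| < 1} &
      forall z, `|z| = 1 ->
        q.[z] / z ^+ n = c * `|\prod_(al <- s) (1 - al^* * z)| ^+ 2].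
Proof.
elim: n q => [|n IH] q sq qp.
  have qc : q = (q`_0)%:P by apply: size1_polyC.
  exists q`_0, [::]; split => //.
    by move: (qp 1 (normr1 _)); rewrite qc hornerC expr0 divr1 coefC.
  move=> z _; rewrite big_nil normr1 expr1n mulr1 expr0 divr1.
  by rewrite {1}qc hornerC.
have circ0 z : `|z| = 1 -> z != 0 by move=> z1; rewrite -normr_eq0 z1 oner_neq0.
(* A positive value equals its own conjugate, so [q] agrees on the circle with its
   conjugate-reciprocal polynomial for degree [2(n+1)]. *)
have qrev : q = reverse_conj n.+1.*2 q.
  apply: poly_eq_on_circle => z z1; have z0 := circ0 _ z1.
  rewrite horner_reverse_conj // (conj_unit_circle z1) invrK.
  have := qp z z1; set y := _ / _ => y0.
  have -> : q.[z] = y * z ^+ n.+1 by rewrite /y divfK // expf_neq0.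
  rewrite rmorphM rmorphXn /= (conj_unit_circle z1) (CrealP (gtr0_real y0)).
  rewrite -addnn exprD exprVn mulrCA; congr (_ * _).
  by rewrite -mulrA divff ?mulr1 // expf_neq0.
(* If [q] vanishes at 0, the symmetry also kills the top coefficient. Dividing by ['X] then lowers
   the degree bound by two, and the trigonometric polynomial is unchanged. *)
have [q00|q00] := eqVneq q`_0 0.
  have q2n : q`_n.+1.*2 = 0.
    by rewrite qrev coef_poly ltnSn subnn q00 rmorph0.
  have /factor_theorem[q1 q1E] : root q 0 by rewrite /root horner_coef0 q00.
  rewrite subr0 in q1E.
  have sq1 : (size q1 <= n.*2.+1)%N.
    apply/leq_sizeP => j; rewrite leq_eqVlt => /orP[/eqP <-|jn].
      by move: q2n; rewrite q1E coefMX doubleS.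
    move/leq_sizeP: sq => /(_ j.+1); rewrite q1E coefMX /=; apply.
    by rewrite doubleS ltnS.
  have q1v z : `|z| = 1 -> q1.[z] / z ^+ n = q.[z] / z ^+ n.+1.
    move=> z1; have z0 := circ0 _ z1.
    by rewrite q1E hornerMX exprSr -mulf_div divff // mulr1.
  have [|c [s [c0 s1 h]]] := IH q1 sq1; first by move=> z z1; rewrite q1v ?qp.
  by exists c, s; split => // z z1; rewrite -q1v // h.
have q0 : q.[0] != 0 by rewrite horner_coef0.
have q2n : q`_n.+1.*2 != 0.
  by rewrite qrev coef_poly ltnSn subnn conjC_eq0.
have [be rbe] : exists be, root q be.
  apply/closed_rootP; rewrite neq_ltn; apply/orP; right.
  rewrite ltnNge; apply/negP => /leq_sizeP /(_ n.+1.*2) h.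
  by move: q2n; rewrite h ?eqxx // doubleS.
have root0 w : root q w -> w != 0.
  by move=> rw; apply: contraTneq rw => ->.
have root_refl w : root q w -> root q (w^*)^-1.
  move=> rw; have w0 := root0 _ rw.
  move: (rw); rewrite {1}qrev /root horner_reverse_conj // mulf_eq0.
  by rewrite expf_eq0 (negPf w0) andbF /= conjC_eq0.
have root1 w : root q w -> `|w| != 1.
  move=> /rootP rw; apply/eqP => w1; have := qp w w1.
  by rewrite rw mul0r ltxx.
have [al ral al1] : exists2 al, root q al & `|al| < 1.
  have [|b1] := boolP (`|be| < 1); first by exists be.
  exists (be^*)^-1; first exact: root_refl.
  rewrite normfV norm_conjC invf_lt1 ?normr_gt0 ?root0 //.
  by rewrite lt_neqAle eq_sym root1 // real_leNgt ?normr_real ?real1.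
have al0 := root0 _ ral.
have alc0 : al^* != 0 by rewrite conjC_eq0.
have [q1 q1E] := factor_theorem _ _ ral.
(* The mirror image of [al] differs from [al], since equality would put [al] on the circle; hence it
   is still a root after ['X - al] is removed. *)
have r1 : root q1 (al^*)^-1.
  have := root_refl _ ral; rewrite {1}q1E rootM root_XsubC => /orP[//|/eqP h].
  have := mulVf alc0; rewrite h -normCK => /eqP.
  by rewrite sqrp_eq1 // (negPf (root1 _ ral)).
have [q2 q2E] := factor_theorem _ _ r1.
(* This scalar turns the monic factor at the mirror root into [1 - al^* 'X]. *)
set q3 := (- (al^*)^-1) *: q2.
have qE : q = q3 * (1 - al^* *: 'X) * ('X - al%:P).
  rewrite q1E q2E /q3; congr (_ * _).
  rewrite -scalerAl scalerAr; congr (_ * _).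
  rewrite scaleNr scalerBr scalerA mulVf // scale1r opprB.
  by rewrite -alg_polyC.
have sq3 : (size q3 <= n.*2.+1)%N.
  rewrite (leq_trans (size_scale_leq _ _)) //.
  have q20 : q2 != 0.
    by apply: contraNneq q0 => q20; rewrite q1E q2E q20 !mul0r horner0.
  have q10 : q1 != 0.
    by apply: contraNneq q0 => q10; rewrite q1E q10 !mul0r horner0.
  move: sq; rewrite q1E size_Mmonic ?monicXsubC // size_XsubC addn2 /=.
  by rewrite q2E size_Mmonic ?monicXsubC // size_XsubC addn2 /= doubleS !ltnS.
clearbody q3.
(* On the circle [(z - al) / z] is the conjugate of [1 - al^* z]. *)
have q3v z : `|z| = 1 ->
    q.[z] / z ^+ n.+1 = q3.[z] / z ^+ n * `|1 - al^* * z| ^+ 2.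
  move=> z1; have z0 := circ0 _ z1.
  rewrite normCK rmorphB rmorph1 rmorphM /= conjCK (conj_unit_circle z1).
  rewrite {1}qE !hornerM hornerXsubC hornerD hornerN hornerZ hornerX hornerC exprSr.
  move: q3.[z] (al^*) => x y; field.
  by rewrite z0 expf_neq0.
have pos z : `|z| = 1 -> 0 < `|1 - al^* * z| ^+ 2.
  move=> z1; rewrite exprn_gt0 // normr_gt0 subr_eq0; apply/eqP => h.
  have := al1; rewrite -(norm_conjC al) -[X in _ < X]normr1 h normrM z1 mulr1.
  by rewrite ltxx.
have [|c [s [c0 s1 h]]] := IH q3 sq3.
  move=> z z1; have := qp z z1.
  by rewrite q3v // pmulr_lgt0 // pos.
exists c, (al :: s); split => //.
  by move=> x; rewrite inE => /predU1P[->//|/s1].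
move=> z z1; rewrite q3v // h // big_cons normrM exprMn.
by rewrite -mulrA (mulrC (_ ^+ 2)).
Qed.

End FejerRiesz.

(** * Complex limits by real and imaginary parts, and limits of products *)

Section ComplexLimits.
Local Open Scope complex_scope.
Variable R : realType.
Implicit Types (z : R[i]).

Lemma ler_normc_ReIm z : `|z| <= (`|complex.Re z| + `|complex.Im z|)%:C.
Proof.
rewrite normc_def lecR -[leRHS]ger0_norm ?addr_ge0 // -sqrtr_sqr.
apply: ler_wsqrtr; rewrite sqrrD !real_normK ?num_real //.
by rewrite addrAC lerDl mulrn_wge0 // mulr_ge0.
Qed.

Lemma normc_ge_Im z : `|complex.Im z|%:C <= `|z|.
Proof.
by rewrite normc_def lecR -sqrtr_sqr ler_wsqrtr // lerDr sqr_ge0.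
Qed.

Lemma sqmodE z : (sqmod z)%:C = `|z| ^+ 2.
Proof. exact: add_Re2_Im2. Qed.

Lemma sqmod_ge0 z : 0 <= sqmod z.
Proof. by rewrite addr_ge0 ?sqr_ge0. Qed.

Lemma sqmodM z w : sqmod (z * w) = sqmod z * sqmod w.
Proof. by case: z w => [a b] [c d]; rewrite /sqmod /=; ring. Qed.

Lemma cvg_complexP (T : Type) (F : set_system T) (FF : Filter F)
    (f : T -> R[i]) (l : R[i]) :
  (f x : R[i]^o) @[x --> F] --> (l : R[i]^o) <->
  complex.Re (f x) @[x --> F] --> complex.Re l /\
  complex.Im (f x) @[x --> F] --> complex.Im l.
Proof.
split.
  move=> /cvgrPdist_le fl; split; apply/cvgrPdist_le => e e0.
    have e0C : 0 < e%:C by rewrite ltcR.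
    apply: filterS (fl _ e0C) => x /(le_trans (normc_ge_Re _)).
    by rewrite raddfB lecR.
  have e0C : 0 < e%:C by rewrite ltcR.
  apply: filterS (fl _ e0C) => x /(le_trans (normc_ge_Im _)).
  by rewrite raddfB lecR.
move=> [/cvgrPdist_le fr /cvgrPdist_le fi]; apply/cvgrPdist_le => -[e e'].
(* A positive element of [R[i]] has zero imaginary part, so the radius is a real number. *)
rewrite ltcE /= => /andP[/eqP -> e0].
have e20 : 0 < e / 2 by rewrite divr_gt0.
apply: filterS2 (fr _ e20) (fi _ e20) => x xr xi.
rewrite (le_trans (ler_normc_ReIm _)) // lecR (splitr e) lerD // raddfB //.
Qed.

Lemma is_cvg_complexP (T : Type) (F : set_system T) (FF : Filter F)
    (f : T -> R[i]) :
  cvg ((f x : R[i]^o) @[x --> F]) <->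
  cvg (complex.Re (f x) @[x --> F]) /\ cvg (complex.Im (f x) @[x --> F]).
Proof.
split=> [/cvg_ex[/= l /cvg_complexP[fr fi]]|[/cvg_ex[/= a fr] /cvg_ex[/= b fi]]].
  by split; [apply/cvg_ex; exists (complex.Re l)|apply/cvg_ex; exists (complex.Im l)].
by apply/cvg_ex; exists (a +i* b); apply/cvg_complexP.
Qed.

End ComplexLimits.

(* At points where the limit does not exist, [lim] is 0 on both sides. *)
Lemma lim_mul_default (K : numFieldType) (T : Type) (F : set_system T)
    (FF : ProperFilter F) (p f : T -> K^o) (l : K^o) :
  p x @[x --> F] --> l -> l != 0 ->
  lim ((p x * f x : K^o) @[x --> F]) = l * lim (f x @[x --> F]).
Proof.
move=> pl l0.
have [fc|fd] := pselect (cvg (f x @[x --> F])).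
  by apply: cvg_lim; [exact: norm_hausdorff|exact: cvgM].
rewrite [in RHS](dvgP fd) mulr0; apply: dvgP => pfc; apply: fd.
have pV : (p x)^-1 @[x --> F] --> l^-1 by apply: cvgV.
have p0 : \forall x \near F, p x != 0 by apply: cvgr_neq0 pl l0.
apply/cvg_ex; exists (l^-1 * lim ((p x * f x : K^o) @[x --> F])).
apply: cvg_trans (cvgM pV pfc); apply: near_eq_cvg.
by apply: filterS p0 => x px0; rewrite /= mulKf.
Qed.

Lemma lim_cst_regular (K : numFieldType) (T : Type) (F : set_system T)
    (FF : ProperFilter F) (l : K^o) : lim ((fun=> l) x @[x --> F]) = l.
Proof. by apply: cvg_lim; [exact: norm_hausdorff|exact: cvg_cst]. Qed.

(** * Polar coordinates and radial boundary values *)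

Section BoundaryValues.
Local Open Scope complex_scope.
Variable R : realType.
Implicit Types (f phi : R[i] -> R[i]) (r t : R).

Lemma norm_cis t : `|cis t| = 1.
Proof. by rewrite normc_def /= cos2Dsin2 sqrtr1. Qed.

Lemma norm_polar r t : 0 <= r -> `|r%:C * cis t| = r%:C.
Proof.
move=> r0; rewrite normrM norm_cis mulr1 normc_def /= expr0n addr0.
by rewrite sqrtr_sqr ger0_norm.
Qed.

Lemma cvg_polar (T : Type) (F : set_system T) (FF : Filter F)
    (r t : T -> R) (r0 t0 : R) :
  r x @[x --> F] --> r0 -> t x @[x --> F] --> t0 ->
  ((r x)%:C * cis (t x) : R[i]^o) @[x --> F] --> (r0%:C * cis t0 : R[i]^o).
Proof.
move=> rr tt; apply/cvg_complexP; rewrite /= !mul0r addr0 subr0.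
have ct : cos (t x) @[x --> F] --> cos t0.
  by apply: continuous_cvg => //; exact: continuous_cos.
have st : sin (t x) @[x --> F] --> sin t0.
  by apply: continuous_cvg => //; exact: continuous_sin.
split.
- under eq_fun do rewrite /= mul0r subr0; exact: cvgM.
- under eq_fun do rewrite /= mul0r addr0; exact: cvgM.
Qed.

Lemma derivable_continuous f z : derivable (f : R[i]^o -> R[i]^o) z 1 ->
  {for z, continuous (f : R[i]^o -> R[i]^o)}.
Proof. by move/derivable1_diffP/differentiable_continuous. Qed.

Lemma cvg_radial phi t :
  {for cis t, continuous (phi : R[i]^o -> R[i]^o)} ->
  (phi (r%:C * cis t) : R[i]^o) @[r --> (1 : R)^'-] --> (phi (cis t) : R[i]^o).
Proof.
move=> phic.
suff h : (r%:C * cis t : R[i]^o) @[r --> (1 : R)^'-] --> (cis t : R[i]^o).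
  exact: cvg_comp h phic.
rewrite -[X in _ --> X]mul1r.
apply: (@cvg_polar _ _ _ id (cst t) 1 t); last exact: cvg_cst.
exact: (cvg_at_left_filter cvg_id).
Qed.

(** A factor continuous and nonzero at [cis t] neither creates nor destroys a radial limit, so the
    identity holds at every such point; where [f] has no radial limit both sides are 0. *)
Lemma boundary_valueM phi f t :
  {for cis t, continuous (phi : R[i]^o -> R[i]^o)} -> phi (cis t) != 0 ->
  boundary_value (fun z => phi z * f z) t = phi (cis t) * boundary_value f t.
Proof.
move=> phic phi0; exact: (@lim_mul_default R[i] _ _ _ (fun r => phi (r%:C * cis t))
  (fun r => f (r%:C * cis t)) (phi (cis t)) (cvg_radial phic) phi0).
Qed.

Lemma boundary_value_cst (c : R[i]) t : boundary_value (fun=> c) t = c.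
Proof. exact: lim_cst_regular. Qed.

End BoundaryValues.

(** * Measurability of left limits at 1 *)

Lemma countable_bigcapT_measurable d (T : measurableType d) (U : Type)
    (F : U -> set T) : countable [set: U] ->
  (forall i, measurable (F i)) -> measurable (\bigcap_i F i).
Proof.
move=> cU mF; rewrite -(setCK (\bigcap_i F i)) setC_bigcap.
by apply: measurableC; apply: countable_bigcupT_measurable => // i;
  exact: measurableC.
Qed.

Section LeftLimits.
Variable R : realType.
Implicit Types (r t : R) (p q : rat).

Lemma ratr_between (a b : R) : a < b -> exists q, a < ratr q < b.
Proof.
move=> ab; have [||x [/= xab [q _ qx]]] := @dense_rat R [set` `]a, b[].
- by exists ((a + b) / 2); rewrite /= in_itv /= !midf_lt.
- exact: interval_open.
- by exists q; move: xab; rewrite in_itv qx.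
Qed.

Lemma near_leftP (P : set R) :
  (\forall r \near 1^'-, P r) ->
  exists n : nat, forall r, 1 - n.+1%:R^-1 < r < 1 -> P r.
Proof.
move=> /nbhs_left0P /nbhs_ballP[e /= e0 eP].
have [n] := ltr_add_invr e0; rewrite add0r => ne.
exists n => r /andP[nr r1].
have := eP (1 - r); rewrite /= subKr; apply; last by rewrite subr_gt0.
rewrite /ball /= sub0r normrN gtr0_norm ?subr_gt0 //.
by rewrite (lt_trans _ ne) // ltrBlDr addrC -ltrBlDr.
Qed.

(* Rational radii suffice in the Cauchy criterion, which makes it a countable
   condition. *)
Lemma is_cvg_left_rat (h : R -> R) :
  (forall r, 0 <= r < 1 -> {for r, continuous h}) ->
  cvg (h r @[r --> 1^'-]) <->
  forall k : nat, exists n : nat, forall pq : rat * rat,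
    1 - n.+1%:R^-1 < (ratr pq.1 : R) < 1 ->
    1 - n.+1%:R^-1 < (ratr pq.2 : R) < 1 ->
    `|h (ratr pq.1) - h (ratr pq.2)| <= k.+1%:R^-1.
Proof.
move=> hc; split.
  move=> /cvg_ex[/= l /cvgrPdist_le hl] k.
  have k0 : 0 < k.+1%:R^-1 / 2 :> R by rewrite divr_gt0 // invr_gt0.
  have [n nP] := near_leftP (hl _ k0).
  exists n => -[p q] /= /nP hp /nP hq.
  rewrite (splitr k.+1%:R^-1) (le_trans (ler_distD l _ _)) // lerD //.
  by rewrite distrC.
move=> hk; apply/cauchy_cvgP; apply: cauchy_exP => e e0.
have e20 : 0 < e / 2 by rewrite divr_gt0.
have [k] := ltr_add_invr e20; rewrite add0r => ke.
have [n nP] := hk k.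
have n1 : 1 - n.+1%:R^-1 < 1 :> R by rewrite ltrBlDr ltrDl invr_gt0.
have [p pn] := ratr_between n1.
exists (h (ratr p)).
have n0 : 0 <= 1 - n.+1%:R^-1 :> R.
  by rewrite subr_ge0 invf_le1 // ler1n.
change (\forall r \near 1^'-, ball (h (ratr p)) e (h r)).
near=> r; rewrite /ball /=.
have rn : 1 - n.+1%:R^-1 < r < 1.
  by apply/andP; split; near: r; [exact: nbhs_left_gt|exact: nbhs_left_lt].
have r01 : 0 <= r < 1.
  by case/andP: rn => /ltW/(le_trans n0) -> ->.
(* Continuity at [r] carries the estimate from a rational [q] slightly below [r] to [r] itself. *)
have [d /= d0 dP] : exists2 d, 0 < d & forall s, `|r - s| < d -> `|h r - h s| < e / 2.
  have /cvgrPdist_lt/(_ _ e20)/nbhs_ballP[d /= d0 dP] := hc _ r01.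
  by exists d => // s rs; apply: dP.
move: (rn) => /andP[nr r1].
have [|q] := @ratr_between (Num.max (1 - n.+1%:R^-1) (r - d)) r.
  by rewrite gt_max nr ltrBlDr ltrDl.
rewrite gt_max => /andP[/andP[nq rdq] qr].
rewrite (le_lt_trans (ler_distD (h (ratr q)) _ _)) // (splitr e) ler_ltD //.
  rewrite (le_trans (nP (p, q) _ _)) ?(ltW ke) //=.
  by rewrite nq (lt_trans qr).
rewrite distrC dP // gtr0_norm ?subr_gt0 //.
by rewrite ltrBlDr addrC -ltrBlDr.
Unshelve. all: by end_near. Qed.

Variable g : R -> R -> R.
Hypothesis gc : forall t r, 0 <= r < 1 -> {for r, continuous (g^~ t)}.
Hypothesis gm : forall r, 0 <= r < 1 -> measurable_fun setT (g r).

(** The rational Cauchy criterion writes the set through countable unions and intersections of the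
    sets [D k n pq], which only involve the measurable functions [g r]. *)
Lemma measurable_cvg_left : measurable [set t | cvg (g r t @[r --> 1^'-])].
Proof.
pose D (k n : nat) (pq : rat * rat) : set R := [set t |
    1 - n.+1%:R^-1 < (ratr pq.1 : R) < 1 ->
    1 - n.+1%:R^-1 < (ratr pq.2 : R) < 1 ->
    `|g (ratr pq.1) t - g (ratr pq.2) t| <= k.+1%:R^-1].
have -> : [set t | cvg (g r t @[r --> 1^'-])] =
    \bigcap_k \bigcup_n \bigcap_pq D k n pq.
  apply/seteqP; split=> t /=.
    move=> /(is_cvg_left_rat (@gc t)) h k _; have [n nP] := h k.
    by exists n => // pq _ /=; exact: nP.
  move=> h; apply/(is_cvg_left_rat (@gc t)) => k.
  have [n _ nP] := h k Logic.I; exists n => pq; exact: nP.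
apply: bigcapT_measurable => k; apply: bigcupT_measurable => n.
apply: countable_bigcapT_measurable; first exact: countableP.
move=> [p q]; rewrite /D /=.
have n0 : 0 <= 1 - n.+1%:R^-1 :> R by rewrite subr_ge0 invf_le1 // ler1n.
(* If one of the two radii lies outside the window, the condition is vacuous and the set is the
   whole line. *)
have [pn|pn] := boolP (1 - n.+1%:R^-1 < (ratr p : R) < 1); last first.
  by rewrite [X in measurable X](_ : _ = setT) //; apply/seteqP; split.
have [qn|qn] := boolP (1 - n.+1%:R^-1 < (ratr q : R) < 1); last first.
  by rewrite [X in measurable X](_ : _ = setT) //; apply/seteqP; split.
have p1 : 0 <= (ratr p : R) < 1.
  by case/andP: pn => /ltW/(le_trans n0) -> ->.
have q1 : 0 <= (ratr q : R) < 1.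
  by case/andP: qn => /ltW/(le_trans n0) -> ->.
have mpq : measurable_fun setT (fun t => `|g (ratr p) t - g (ratr q) t|).
  apply: measurableT_comp => //; apply: measurable_funB; exact: gm.
have := mpq measurableT [set` `]-oo, k.+1%:R^-1]] (measurable_itv _).
rewrite setTI; congr (measurable _).
apply/seteqP; split=> t /=; rewrite in_itv /= => h //.
exact: h.
Qed.

(** [v] is the pointwise limit of the functions [\1_E * g (u n)] along the sequence
    [u n = 1 - 1/(n+1)]; the indicator produces the value 0 off [E]. *)
Lemma measurable_fun_left_limit (E : set R) (v : R -> R) : measurable E ->
  (forall t, E t -> g r t @[r --> 1^'-] --> v t) ->
  (forall t, ~ E t -> v t = 0) -> measurable_fun setT v.
Proof.
move=> mE Ev v0.
pose u (n : nat) : R := 1 - n.+1%:R^-1.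
have un n : 0 <= u n < 1.
  by rewrite subr_ge0 invf_le1 // ler1n ltrBlDr ltrDl invr_gt0 ltr0n.
have u1 : u n @[n --> \oo] --> (1 : R).
  rewrite -[X in _ --> X]subr0; apply: cvgB; first exact: cvg_cst.
  exact: cvg_harmonic.
apply: (@measurable_fun_cvg _ _ _ _
  (fun n t => \1_E t * g (u n) t)).
- by move=> n; apply: measurable_funM => //; exact: gm.
- move=> t _; rewrite /indic; have [tE|tE] := boolP (t \in E).
    rewrite /=; under eq_fun do rewrite mul1r.
    have /cvg_at_leftP := Ev t (set_mem tE); apply; split => // n.
    by case/andP: (un n).
  rewrite v0; last by move=> Et; move: tE; rewrite mem_set.
  rewrite /=; under eq_fun do rewrite mul0r; exact: cvg_cst.
Qed.

End LeftLimits.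

(** * Hardy space functions: measurability and bounded multipliers *)

Section HardySpace.
Local Open Scope complex_scope.
Variable R : realType.
Implicit Types (f phi : R[i] -> R[i]) (r t : R).

(** An arbitrary filter covers both uses: continuity in the angle, for measurability on a circle,
    and continuity in the radius, for the radial limits. *)
Lemma holomorphic_polar_cvg (T : Type) (F : set_system T) (FF : Filter F)
    f (rho tau : T -> R) r t :
  holomorphic_on (@unit_disk R) f -> 0 <= r < 1 ->
  rho x @[x --> F] --> r -> tau x @[x --> F] --> t ->
  (f ((rho x)%:C * cis (tau x)) : R[i]^o) @[x --> F] -->
    (f (r%:C * cis t) : R[i]^o).
Proof.
move=> fh /andP[r0 r1] rr tt.
have fc : {for r%:C * cis t, continuous (f : R[i]^o -> R[i]^o)}.
  apply: derivable_continuous; apply: fh.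
  by rewrite /unit_disk /= norm_polar // ltcR.
have h : ((rho x)%:C * cis (tau x) : R[i]^o) @[x --> F] -->
    (r%:C * cis t : R[i]^o) by exact: cvg_polar.
exact: cvg_comp h fc.
Qed.

Lemma measurable_holomorphic_circle f r :
  holomorphic_on (@unit_disk R) f -> 0 <= r < 1 ->
  measurable_fun setT (fun t => complex.Re (f (r%:C * cis t))) /\
  measurable_fun setT (fun t => complex.Im (f (r%:C * cis t))).
Proof.
move=> fh r01.
have h t : (f (r%:C * cis s) : R[i]^o) @[s --> t] --> (f (r%:C * cis t) : R[i]^o).
  exact: (@holomorphic_polar_cvg _ _ _ f (cst r) id r t fh r01 (cvg_cst _) cvg_id).
split; apply: continuous_measurable_fun => t; have /cvg_complexP[] := h t; by [].
Qed.

Lemma measurable_boundary_value f : holomorphic_on (@unit_disk R) f ->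
  measurable_fun setT (fun t => complex.Re (boundary_value f t)) /\
  measurable_fun setT (fun t => complex.Im (boundary_value f t)).
Proof.
move=> fh.
have mf r (r01 : 0 <= r < 1) := measurable_holomorphic_circle fh r01.
have fc t r : 0 <= r < 1 ->
    {for r, continuous (fun s : R => complex.Re (f (s%:C * cis t)))} /\
    {for r, continuous (fun s : R => complex.Im (f (s%:C * cis t)))}.
  move=> r01; apply/cvg_complexP.
  exact: (@holomorphic_polar_cvg _ _ _ f id (cst t) r t fh r01 cvg_id (cvg_cst _)).
set gr := fun r t => complex.Re (f (r%:C * cis t)).
set gi := fun r t => complex.Im (f (r%:C * cis t)).
have grc t r : 0 <= r < 1 -> {for r, continuous (gr^~ t)} by move=> /(fc t)[].
have gic t r : 0 <= r < 1 -> {for r, continuous (gi^~ t)} by move=> /(fc t)[].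
have grm r : 0 <= r < 1 -> measurable_fun setT (gr r) by move=> /mf[].
have gim r : 0 <= r < 1 -> measurable_fun setT (gi r) by move=> /mf[].
(* The complex limit exists only when both parts converge; if one part diverges, [boundary_value] is
   0 in both components, hence the intersection. *)
pose E := [set t | cvg (gr r t @[r --> 1^'-])] `&`
  [set t | cvg (gi r t @[r --> 1^'-])].
have mE : measurable E.
  by apply: measurableI; apply: measurable_cvg_left.
have Ev t : E t -> (f (r%:C * cis t) : R[i]^o) @[r --> (1 : R)^'-] -->
    (boundary_value f t : R[i]^o).
  by move=> Et; apply/is_cvg_complexP.
have v0 t : ~ E t -> boundary_value f t = 0.
  by move=> Et; apply: (@dvgP R[i]^o) => /is_cvg_complexP.
split.
- apply: (measurable_fun_left_limit grm mE).
    by move=> t /Ev /cvg_complexP[].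
  by move=> t /v0 ->.
- apply: (measurable_fun_left_limit gim mE).
    by move=> t /Ev /cvg_complexP[].
  by move=> t /v0 ->.
Qed.

Lemma hardy2M phi f (K : R) : holomorphic_on (@unit_disk R) phi ->
  (forall z, unit_disk z -> sqmod (phi z) <= K) ->
  hardy2 f -> hardy2 (fun z => phi z * f z).
Proof.
move=> phih phiK [fh [B fB]].
have K0 : 0 <= K.
  apply: le_trans (sqmod_ge0 _) (phiK 0 _).
  by rewrite /unit_disk /= normr0 ltr01.
have phifh : holomorphic_on (@unit_disk R) (fun z => phi z * f z).
  by move=> z z1; apply: derivableM; [exact: phih|exact: fh].
split => //.
exists (K * B) => r r01.
have msq h : holomorphic_on (@unit_disk R) h ->
    measurable_fun setT (fun t => sqmod (h (r%:C * cis t))).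
  move=> hh; have [mr mi] := measurable_holomorphic_circle hh r01.
  by apply: measurable_funD; apply: measurable_funX.
have emsq h : holomorphic_on (@unit_disk R) h ->
    measurable_fun `[0, 2 * pi]%classic (fun t => (sqmod (h (r%:C * cis t)))%:E).
  move=> /msq hh; apply/measurable_EFinP; exact: measurable_funTS.
have pi0 : 0 <= (2 * pi)^-1 :> R by rewrite invr_ge0 mulr_ge0 // pi_ge0.
rewrite EFinM; apply: le_trans (lee_wpmul2l _ (fB r r01)); last by rewrite lee_fin.
rewrite muleCA lee_wpmul2l ?lee_fin //.
rewrite -ge0_integralZl; [|exact: measurable_itv|exact: emsq| |by rewrite lee_fin];
  last by move=> t _; rewrite lee_fin sqmod_ge0.
apply: ge0_le_integral => //=.
- by move=> t _; rewrite lee_fin sqmod_ge0.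
- exact: emsq phifh.
- by apply: measurable_funeM; exact: emsq.
move=> t _; rewrite -EFinM lee_fin sqmodM ler_wpM2r ?sqmod_ge0 //.
case/andP: r01 => r0 r1; apply: phiK.
by rewrite /unit_disk /= norm_polar // ltcR.
Qed.

Lemma hardy2_1 : hardy2 (fun=> 1 : R[i]).
Proof.
have pi0 : 0 < 2 * pi :> R by rewrite mulr_gt0 // pi_gt0.
split; first by move=> z _; exact: derivable_cst.
exists 1 => r _.
rewrite integral_cst //= lebesgue_measure_itv /= lte_fin pi0 -EFinB subr0.
by rewrite -!EFinM /sqmod /= expr1n expr0n addr0 mul1r mulVf // gt_eqF.
Qed.

End HardySpace.

(** * Integrals against weights bounded away from 0 and infinity *)

Section WeightedIntegrals.
Context d (T : measurableType d) (R : realType) (mu : {measure set T -> \bar R}).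
Variables (D : set T) (mD : measurable D).

(** The integrals of the positive and negative parts add up to [+oo], so at least one is infinite.
    Their extended difference is then infinite as well, and its real value is 0 by convention. *)
Lemma Rintegral_nonintegrable (F : T -> R) : measurable_fun D F ->
  ~ mu.-integrable D (EFin \o F) -> \int[mu]_(x in D) F x = 0.
Proof.
move=> mF nF; rewrite /Rintegral integralE.
have mEF : measurable_fun D (EFin \o F) by exact/measurable_EFinP.
have a0 : (0 <= \int[mu]_(x in D) ((EFin \o F)^\+ x))%E by exact: integral_ge0.
have b0 : (0 <= \int[mu]_(x in D) ((EFin \o F)^\- x))%E by exact: integral_ge0.
have : (\int[mu]_(x in D) ((EFin \o F)^\+ x) + \int[mu]_(x in D) ((EFin \o F)^\- x) = +oo)%E.
  rewrite -ge0_integralD //; first last.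
  - exact: measurable_funeneg.
  - exact: measurable_funepos.
  apply/eqP; rewrite eq_le leey /= leNgt; apply/negP => abs; apply: nF.
  apply/integrableP; split => //; apply: le_lt_trans abs.
  rewrite le_eqVlt; apply/orP; left; apply/eqP; apply: eq_integral => x _.
  by rewrite -[LHS]/((abse \o (EFin \o F)) x) fune_abse.
move: (\int[mu]_(x in D) _)%E (\int[mu]_(x in D) _)%E a0 b0.
by move=> [a| |] [b| |].
Qed.

Definition positively_bounded (w : T -> R) :=
  exists m K : R, 0 < m /\ forall x, D x -> m <= w x <= K.

(** Domination in both directions: [|F| <= m^-1 |w F|] and [|w F| <= K |F|]. *)
Lemma integrable_weight (w F : T -> R) :
  measurable_fun D w -> measurable_fun D F -> positively_bounded w ->
  mu.-integrable D (EFin \o (fun x => w x * F x)) <->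
  mu.-integrable D (EFin \o F).
Proof.
move=> mw mF [m [K [m0 wmK]]].
have w0 x : D x -> 0 < w x by move=> /wmK/andP[/(lt_le_trans m0)].
split=> hF.
- have := integrableZl mD m^-1 hF.
  apply: le_integrable => //; first exact/measurable_EFinP.
  move=> x Dx; rewrite /= lee_fin !normrM (gtr0_norm (w0 _ Dx)).
  rewrite gtr0_norm ?invr_gt0 // mulrA ler_peMl //.
  rewrite mulrC ler_pdivlMr // mul1r.
  by case/andP: (wmK _ Dx).
- have := integrableZl mD K hF.
  apply: le_integrable => //.
    exact/measurable_EFinP/measurable_funM.
  move=> x Dx; rewrite /= lee_fin !normrM ler_wpM2r //.
  case/andP: (wmK _ Dx) => mwx wK; rewrite (gtr0_norm (w0 _ Dx)).
  exact: le_trans (ler_norm _).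
Qed.

(* If [F] is not integrable, then neither is any of the products below, and all
   integrals take the default value 0. *)
Lemma Rintegral_weighted_sum (I : finType) (c : I -> R) (w : I -> T -> R)
    (W F : T -> R) :
  measurable_fun D F ->
  (forall i, measurable_fun D (w i)) -> (forall i, positively_bounded (w i)) ->
  measurable_fun D W -> positively_bounded W ->
  (forall x, D x -> W x = \sum_i c i * w i x) ->
  \int[mu]_(x in D) (W x * F x) = \sum_i c i * \int[mu]_(x in D) (w i x * F x).
Proof.
move=> mF mw bw mW bW WE.
have [iF|niF] := pselect (mu.-integrable D (EFin \o F)); last first.
  rewrite Rintegral_nonintegrable; first last.
  - by move=> /(integrable_weight mW mF bW).
  - exact: measurable_funM.
  rewrite big1 // => i _; rewrite Rintegral_nonintegrable ?mulr0 //.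
  - exact: measurable_funM.
  - by move=> /(integrable_weight (mw i) mF (bw i)).
have iwF i : mu.-integrable D (EFin \o (fun x => w i x * F x)).
  exact/integrable_weight.
have icwF i : mu.-integrable D (EFin \o (fun x => c i * (w i x * F x))).
  exact: (integrableZl mD (c i) (iwF i)).
transitivity (\int[mu]_(x in D) (\sum_i c i * (w i x * F x))).
  apply: eq_Rintegral => x /set_mem Dx; rewrite WE // mulr_suml.
  by apply: eq_bigr => i _; rewrite mulrA.
transitivity (\sum_i \int[mu]_(x in D) (c i * (w i x * F x))); last first.
  by apply: eq_bigr => i _; rewrite RintegralZl.
(* Integrability is carried along the list induction, because additivity of the integral asks for it
   at each partial sum. *)
suff : forall s : seq I,
    mu.-integrable D (EFin \o (fun x => \sum_(i <- s) c i * (w i x * F x))) /\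
    \int[mu]_(x in D) (\sum_(i <- s) c i * (w i x * F x)) =
    \sum_(i <- s) \int[mu]_(x in D) (c i * (w i x * F x)).
  by move=> /(_ (index_enum I))[].
elim=> [|i s [is_ IH]].
  split; last by rewrite big_nil; under eq_Rintegral do rewrite big_nil;
    rewrite Rintegral_cst // mul0r.
  apply: (eq_integrable mD (cst 0%E)); last exact: integrable0.
  by move=> x _ /=; rewrite big_nil.
split.
  apply: eq_integrable (integrableD mD (icwF i) is_) => //.
  by move=> x _ /=; rewrite big_cons EFinD.
rewrite big_cons -IH -RintegralD //; apply: eq_Rintegral => x _.
by rewrite big_cons.
Qed.

End WeightedIntegrals.

(** * The integral of the Poisson kernel *)

Section PoissonKernel.
Variable R : realType.
Local Open Scope complex_scope.

Lemma Re_one_sub_gt0 (z : R[i]) : `|z| < 1 -> 0 < complex.Re (1 - z).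
Proof.
move=> z1; rewrite raddfB subr_gt0.
by have := le_lt_trans (normc_ge_Re z) z1; rewrite ltcR; apply: le_lt_trans (ler_norm _).
Qed.

Lemma sqmod_lt1 (z : R[i]) : (sqmod z < 1) = (`|z| < 1).
Proof. by rewrite -ltcR sqmodE expr_lt1. Qed.

(* The antiderivative is [t - 2 arg (1 - a^* cis t)]. *)
Lemma poisson_integral (a : R[i]) : `|a| < 1 ->
  \int[@lebesgue_measure R]_(t in `[0, 2 * pi])
    ((1 - sqmod a) / sqmod (1 - (a^*)%C * cis t)) = 2 * pi.
Proof.
move=> a1; case: a a1 => x y a1.
(* [U] and [V] are the real and imaginary parts of [1 - a^* cis t]. As [U > 0], its argument is
   [atan (V / U)] for every [t]. *)
pose U (t : R) := 1 - (x * cos t + y * sin t).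
pose V (t : R) := y * cos t - x * sin t.
have UVE t : sqmod (1 - (x -i* y)%C * cis t) = U t ^+ 2 + V t ^+ 2.
  by rewrite /sqmod /U /V /=; ring.
have U0 t : 0 < U t.
  have := @Re_one_sub_gt0 ((x -i* y)%C * cis t); rewrite /U /= mulNr opprK; apply.
  by rewrite normrM norm_cis mulr1 -[_ -i* _]/((x +i* y)^*)%C normcJ.
have UV0 t : 0 < U t ^+ 2 + V t ^+ 2.
  by rewrite ltr_wpDr ?sqr_ge0 // exprn_gt0.
pose F (t : R) := t - 2 * atan (V t / U t).
pose P (t : R) := (1 - (x ^+ 2 + y ^+ 2)) / (U t ^+ 2 + V t ^+ 2).
have dU (t : R) : is_derive t (1 : R) U (- V t).
  rewrite /U /V; apply: is_derive_eq.
  by rewrite /GRing.scale /=; ring.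
have dV (t : R) : is_derive t (1 : R) V (U t - 1).
  rewrite /U /V; apply: is_derive_eq.
  by rewrite /GRing.scale /=; ring.
have dF (t : R) : is_derive t (1 : R) F (P t).
  have U0t : U t != 0 by rewrite gt_eqF.
  have dUV : is_derive t (1 : R) (fun s => V s / U s)
      ((U t ^+ 2 + V t ^+ 2 - U t) / U t ^+ 2).
    apply: (is_derive_eq (is_deriveM (dV t) (is_deriveV U0t (dU t)))); rewrite /GRing.scale /=; field.
    exact: U0t.
  have datan : is_derive t (1 : R) (fun s => atan (V s / U s))
      ((1 + (V t / U t) ^+ 2)^-1 * ((U t ^+ 2 + V t ^+ 2 - U t) / U t ^+ 2)).
    exact: (@is_derive1_comp _ atan (fun s => V s / U s)).
  apply: (is_derive_eq (is_deriveB (is_derive_id t 1) (is_deriveZ 2 datan))); rewrite /GRing.scale /= /P.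
  (* This is [|1 - w|^2 = 1 - 2 Re w + |w|^2] for [w = a^* cis t], whose modulus is [|a|]. *)
  have -> : 1 - (x ^+ 2 + y ^+ 2) = 2 * U t - (U t ^+ 2 + V t ^+ 2).
    rewrite /U /V.
    have -> : x ^+ 2 + y ^+ 2 = (x ^+ 2 + y ^+ 2) * (cos t ^+ 2 + sin t ^+ 2).
      by rewrite cos2Dsin2 mulr1.
    ring.
  field.
  by rewrite gt_eqF ?UV0 // U0t.
have Pc : continuous P.
  move=> t; apply: cvgM; first exact: cvg_cst.
  apply: cvgV; first by rewrite gt_eqF.
  have Uc : {for t, continuous U}.
    by apply/differentiable_continuous/derivable1_diffP; exact: ex_derive.
  have Vc : {for t, continuous V}.
    by apply/differentiable_continuous/derivable1_diffP; exact: ex_derive.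
  exact: (cvgD (cvgM Uc Uc) (cvgM Vc Vc)).
have pi0 : 0 < 2 * pi :> R by rewrite mulr_gt0 // pi_gt0.
rewrite /Rintegral; under eq_integral do rewrite UVE.
rewrite (@continuous_FTC2 _ P F 0 (2 * pi)) //.
(* The arctangent takes equal values at both ends of the period, so the increment of [F] comes from
   [t] alone. *)
- have VU0 : V (2 * pi) / U (2 * pi) = V 0 / U 0.
    by rewrite /V /U mulr_natl cos2pi sin2pi cos0 sin0.
  by rewrite -EFinB /= /F VU0 sub0r opprK addrNK.
- exact: continuous_subspaceT.
- have Fc s : {for s, continuous F}.
    by apply/differentiable_continuous/derivable1_diffP; exact: ex_derive.
  split; first by move=> s _; exact: ex_derive.
    exact: (cvg_at_right_filter (Fc 0)).
  exact: (cvg_at_left_filter (Fc (2 * pi))).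
- by move=> t _; rewrite derive1E; apply: derive_val.
Qed.

End PoissonKernel.

(** * Multipliers regular up to the unit circle *)

Section CircleMultipliers.
Local Open Scope complex_scope.
Variable R : realType.
Implicit Types (phi psi f g : R[i] -> R[i]) (a z : R[i]).

(** Differentiability at the points of the circle gives continuity there, so the boundary value is
    [phi (cis t)]. The two-sided bound makes the class closed under inversion and
    [sqmod (phi (cis t))] an admissible weight. *)
Definition circle_multiplier phi :=
  (forall z, `|z| <= 1 -> derivable (phi : R[i]^o -> R[i]^o) z 1) /\
  exists m K : R, 0 < m /\ forall z, `|z| <= 1 -> m <= sqmod (phi z) <= K.

Lemma sqmod_eq0 z : (sqmod z == 0) = (z == 0).
Proof.
by rewrite -(inj_eq (@complexI R)) sqmodE expf_eq0 normr_eq0.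
Qed.

Lemma sqmodV z : sqmod z^-1 = (sqmod z)^-1.
Proof. by apply: (@complexI R); rewrite fmorphV /= !sqmodE normfV exprVn. Qed.

Lemma sqmod_real (x : R) : sqmod x%:C = x ^+ 2.
Proof. by rewrite /sqmod /= expr0n addr0. Qed.

Lemma circle_multiplier_neq0 phi z : circle_multiplier phi -> `|z| <= 1 ->
  phi z != 0.
Proof.
move=> [_ [m [K [m0 h]]]] /h /andP[mz _].
by rewrite -sqmod_eq0 gt_eqF // (lt_le_trans m0).
Qed.

Lemma circle_multiplierM phi psi : circle_multiplier phi ->
  circle_multiplier psi -> circle_multiplier (fun z => phi z * psi z).
Proof.
move=> [dphi [m [K [m0 hphi]]]] [dpsi [n [L [n0 hpsi]]]]; split.
  by move=> z z1; apply: derivableM; [exact: dphi|exact: dpsi].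
exists (m * n), (K * L); split; first exact: mulr_gt0.
move=> z z1; have /andP[a1 a2] := hphi z z1; have /andP[b1 b2] := hpsi z z1.
by rewrite sqmodM !ler_pM ?sqmod_ge0 // ltW.
Qed.

Lemma circle_multiplierV phi : circle_multiplier phi ->
  circle_multiplier (fun z => (phi z)^-1).
Proof.
move=> cphi; have [dphi [m [K [m0 hphi]]]] := cphi; split.
  move=> z z1; apply: derivableV; last exact: dphi.
  exact: circle_multiplier_neq0.
have K0 : 0 < K.
  have /andP[mz zK] : m <= sqmod (phi 0) <= K by apply: hphi; rewrite normr0.
  exact: lt_le_trans m0 (le_trans mz zK).
exists K^-1, m^-1; split; first by rewrite invr_gt0.
move=> z z1; have /andP[a1 a2] := hphi z z1.
have p0 := lt_le_trans m0 a1.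
by rewrite sqmodV !lef_pV2 ?posrE // a1 a2.
Qed.

Lemma circle_multiplier_cst c : c != 0 -> circle_multiplier (fun=> c).
Proof.
move=> c0; split; first by move=> z _; exact: derivable_cst.
exists (sqmod c), (sqmod c); split; last by move=> z _; rewrite lexx.
by rewrite lt_neqAle sqmod_ge0 eq_sym sqmod_eq0 c0.
Qed.

(** On the closed disk [|a^* z| <= |a| < 1], so the modulus lies between [1 - |a|] and 2. *)
Lemma circle_multiplier_linear a : `|a| < 1 ->
  circle_multiplier (fun z => 1 - (a^*)%C * z).
Proof.
move=> a1; split.
  move=> z _; apply: derivableB; first exact: derivable_cst.
  apply: derivableM; first exact: derivable_cst.
  exact: derivable_id.
have [r ra] : exists r : R, `|a| = r%:C by rewrite normc_def; eexists.
rewrite ra in a1; have r1 : r < 1 by rewrite ltcR in a1.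
have cr : `|(a^*)%C| = r%:C by rewrite normcJ.
exists ((1 - r) ^+ 2), 4; split; first by rewrite exprn_gt0 // subr_gt0.
move=> z z1.
have az : `|(a^*)%C * z| <= r%:C.
  by rewrite normrM cr ler_piMr // -ra.
rewrite -!lecR sqmodE; apply/andP; split.
  rewrite rmorphXn /= lerXn2r ?nnegrE ?normr_ge0 //.
    by rewrite lecR subr_ge0 ltW.
  rewrite rmorphB /= (le_trans _ (lerB_dist _ _)) // normr1 lerB //.
rewrite (_ : 4%:C = 2 ^+ 2); last by rewrite -natrX rmorph_nat.
rewrite lerXn2r ?nnegrE ?normr_ge0 //.
rewrite (le_trans (ler_normB _ _)) // normr1 (natrD _ 1 1) lerD //.
by rewrite (le_trans az) // ltW.
Qed.

Lemma circle_multiplier_prod (I : Type) (s : seq I) (P : pred I)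
    (F : I -> R[i] -> R[i]) :
  (forall i, P i -> circle_multiplier (F i)) ->
  circle_multiplier (fun z => \prod_(i <- s | P i) F i z).
Proof.
move=> cF; elim: s => [|i s IH].
  have -> : (fun z => \prod_(i <- [::] | P i) F i z) = fun=> 1.
    by apply/funext => z; rewrite big_nil.
  by apply: circle_multiplier_cst; rewrite oner_neq0.
have -> : (fun z => \prod_(j <- i :: s | P j) F j z) = (fun z =>
    if P i then F i z * \prod_(j <- s | P j) F j z
    else \prod_(j <- s | P j) F j z).
  by apply/funext => z; rewrite big_cons.
by case Pi: (P i) => //; apply: circle_multiplierM => //; exact: cF.
Qed.

Lemma circle_multiplier_szego a : `|a| < 1 ->
  circle_multiplier (szego_normalized a).
Proof.
move=> a1; apply: circle_multiplierM.
  apply: circle_multiplier_cst.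
  by rewrite -sqmod_eq0 sqmod_real expf_eq0 /= sqrtr_eq0 -ltNge subr_gt0 sqmod_lt1.
exact/circle_multiplierV/circle_multiplier_linear.
Qed.

Lemma circle_multiplier_hardy2 phi : circle_multiplier phi ->
  is_multiplier (@hardy2 R) phi.
Proof.
move=> [dphi [m [K [m0 hphi]]]] f; apply: (hardy2M (K := K)).
  by move=> z z1; apply: dphi; exact: ltW.
by move=> z z1; have /andP[] := hphi z (ltW z1).
Qed.

Lemma positively_bounded_circle phi (D : set R) : circle_multiplier phi ->
  positively_bounded D (fun t => sqmod (phi (cis t))).
Proof.
move=> [_ [m [K [m0 hphi]]]]; exists m, K; split => // t _.
by apply: hphi; rewrite norm_cis.
Qed.

Lemma measurable_circle phi (D : set R) : circle_multiplier phi ->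
  measurable_fun D (fun t => sqmod (phi (cis t))).
Proof.
move=> [dphi _]; apply: measurable_funTS.
have cphi t : (phi (cis s) : R[i]^o) @[s --> t] --> (phi (cis t) : R[i]^o).
  have h : (cis s : R[i]^o) @[s --> t] --> (cis t : R[i]^o).
    by apply/cvg_complexP; split; [exact: continuous_cos|exact: continuous_sin].
  have pc : {for cis t, continuous (phi : R[i]^o -> R[i]^o)}.
    by apply: derivable_continuous; apply: dphi; rewrite norm_cis.
  exact: cvg_comp h pc.
apply: measurable_funD; apply: measurable_funX;
  apply: continuous_measurable_fun => t; by have /cvg_complexP[] := cphi t.
Qed.

(** The multiplier enters only through its squared modulus on the circle, which reduces identities
    between inner products to identities between weights. *)
Lemma hardy2_ip_circle_multiplier phi f g : circle_multiplier phi ->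
  hardy2_ip (fun z => phi z * f z) (fun z => phi z * g z) =
  circle_mean (fun t => (sqmod (phi (cis t)))%:C *
    (boundary_value f t * ((boundary_value g t)^*)%C)).
Proof.
move=> cphi; rewrite /hardy2_ip; congr circle_mean; apply/funext => t.
have pc : {for cis t, continuous (phi : R[i]^o -> R[i]^o)}.
  by apply: derivable_continuous; apply: cphi.1; rewrite norm_cis.
have p0 : phi (cis t) != 0.
  by apply: circle_multiplier_neq0 => //; rewrite norm_cis.
rewrite !boundary_valueM // sqmodE normCK rmorphM /=.
by rewrite mulrACA.
Qed.

End CircleMultipliers.

(** * The spectral factor of the kernel weight *)

Section SpectralFactor.
Local Open Scope complex_scope.
Variables (R : realType) (M : nat) (a : 'I_M -> R[i]).
Hypothesis a1 : forall m, `|a m| < 1.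

(* The constant 1 for [i = ord0], the kernel at [a m] for [i = lift ord0 m]. *)
Definition kernel_family (i : 'I_M.+1) (z : R[i]) : R[i] :=
  \prod_(m | lift ord0 m == i) szego_normalized (a m) z.

Lemma kernel_family0 z : kernel_family ord0 z = 1.
Proof. by rewrite /kernel_family big1. Qed.

Lemma kernel_family_lift m z :
  kernel_family (lift ord0 m) z = szego_normalized (a m) z.
Proof.
by rewrite /kernel_family (big_pred1 m) // => j; rewrite (inj_eq (@lift_inj _ ord0)).
Qed.

Lemma circle_multiplier_kernel_family i : circle_multiplier (kernel_family i).
Proof. by apply: circle_multiplier_prod => m _; exact: circle_multiplier_szego. Qed.

Lemma sqmod_szego (b z : R[i]) : `|b| < 1 ->
  sqmod (szego_normalized b z) = (1 - sqmod b) / sqmod (1 - (b^*)%C * z).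
Proof.
move=> b1; rewrite sqmodM sqmodV sqmod_real sqr_sqrtr //.
by rewrite subr_ge0 ltW // sqmod_lt1.
Qed.

(** Over the common denominator of the weights, the [i]-th numerator has on the circle a factor
    [|1 - (a m)^* z|^2] for each [m], except that the kernel present in it leaves [1 - |a m|^2].
    Each factor is multiplied by [z] to become a polynomial. *)
Definition kernel_numerator_factor (i : 'I_M.+1) (m : 'I_M) : {poly R[i]} :=
  if lift ord0 m == i then (1 - sqmod (a m))%:C *: 'X
  else (1 - ((a m)^*)%C *: 'X) * ('X - (a m)%:P).

Lemma size_kernel_numerator_factor i m :
  (size (kernel_numerator_factor i m) <= 3)%N.
Proof.
rewrite /kernel_numerator_factor; case: ifP => _.
  by rewrite (leq_trans (size_scale_leq _ _)) // size_polyX.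
rewrite (leq_trans (size_polyMleq _ _)) // size_XsubC addn2 /= ltnS.
rewrite (leq_trans (size_polyD _ _)) // geq_max size_poly1 size_polyN.
by rewrite (leq_trans (size_scale_leq _ _)) // size_polyX.
Qed.

Lemma horner_kernel_numerator_factor i m z : `|z| = 1 ->
  (kernel_numerator_factor i m).[z] / z =
  (sqmod (1 - ((a m)^*)%C * z))%:C *
    (if lift ord0 m == i then (sqmod (szego_normalized (a m) z))%:C else 1).
Proof.
move=> z1; have z0 : z != 0 by rewrite -normr_eq0 z1 oner_neq0.
have b0 : 1 - ((a m)^*)%C * z != 0.
  apply: (circle_multiplier_neq0 (circle_multiplier_linear (a1 m))).
  by rewrite z1.
rewrite /kernel_numerator_factor; case: ifP => _.
  rewrite hornerZ hornerX mulfK // sqmod_szego // -rmorphM /= mulrC divfK //.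
  by rewrite sqmod_eq0.
rewrite mulr1 hornerM hornerXsubC hornerD hornerN hornerZ hornerX hornerC.
rewrite sqmodE normCK rmorphB rmorph1 rmorphM /= conjCK (conj_unit_circle z1).
by rewrite -mulrA; congr (_ * _); rewrite mulrBl divff.
Qed.

Lemma spectral_factor (theta : 'I_M.+1 -> R) :
  (forall i, 0 <= theta i) -> \sum_i theta i = 1 ->
  exists psi : R[i] -> R[i], circle_multiplier psi /\
    forall t, sqmod (psi (cis t)) =
      \sum_i theta i * sqmod (kernel_family i (cis t)).
Proof.
move=> th0 th1.
pose q : {poly R[i]} :=
  \sum_i (theta i)%:C *: \prod_m kernel_numerator_factor i m.
pose w z : R := \sum_i theta i * sqmod (kernel_family i z).
pose b z : R[i] := \prod_m (1 - ((a m)^*)%C * z).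
have cb : circle_multiplier b.
  by apply: circle_multiplier_prod => m _; exact: circle_multiplier_linear.
have sq : (size q <= M.*2.+1)%N.
  apply: (leq_trans (size_sum _ _ _)); apply/bigmax_leqP => i _.
  rewrite (leq_trans (size_scale_leq _ _)) // (leq_trans (size_prod_leq _ _)) //.
  (* The product of [M] factors of size at most 3 has size at most [3M + 1 - M]. *)
  rewrite card_ord leq_subLR -addnn -addnS addnA.
  rewrite addnS ltnS (@leq_trans (\sum_(m < M) 3)%N) //.
    by apply: leq_sum => m _; exact: size_kernel_numerator_factor.
  by rewrite sum_nat_const card_ord mulnC !mulSn mul0n addn0 addnA.
have qE z : `|z| = 1 -> q.[z] / z ^+ M = (sqmod (b z) * w z)%:C.
  move=> z1; rewrite horner_sum mulr_suml /w mulr_sumr rmorph_sum /=.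
  apply: eq_bigr => i _; rewrite hornerZ horner_prod -mulrA.
  rewrite !rmorphM /= [RHS]mulrCA; congr (_ * _).
  have -> : z ^+ M = \prod_(m < M) z by rewrite prodr_const card_ord.
  rewrite -prodf_div (eq_bigr _ (fun m _ => horner_kernel_numerator_factor i m z1)).
  rewrite big_split /= -big_mkcond /=.
  have sqp (P : pred 'I_M) (F : 'I_M -> R[i]) :
      (sqmod (\prod_(m | P m) F m))%:C = \prod_(m | P m) (sqmod (F m))%:C.
    rewrite sqmodE normr_prod -prodrXl; apply: eq_bigr => m _.
    by rewrite sqmodE.
  by rewrite !sqp.
(* The weights sum to 1, so some [theta i] is positive, and its kernel has no zero on the circle. *)
have w0 z : `|z| = 1 -> 0 < w z.
  move=> z1; have th_nz : \sum_i theta i != 0 by rewrite th1 oner_neq0.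
  have [i _ thi] : exists2 i : 'I_M.+1, true & theta i != 0.
    apply/exists_inP; apply: contraNT th_nz => /exists_inPn h.
    by rewrite big1 // => i _; apply/eqP; have := h i isT; rewrite negbK.
  rewrite /w (bigD1 i) //= ltr_wpDr //.
    by rewrite sumr_ge0 // => j _; rewrite mulr_ge0 // sqmod_ge0.
  rewrite mulr_gt0 // lt_neqAle eq_sym ?thi ?th0 // sqmod_ge0 sqmod_eq0 andbT.
  by apply: circle_multiplier_neq0; rewrite ?z1 //; exact: circle_multiplier_kernel_family.
have qpos z : `|z| = 1 -> 0 < q.[z] / z ^+ M.
  move=> z1; rewrite qE // ltcR mulr_gt0 ?w0 // lt_neqAle sqmod_ge0 eq_sym.
  by rewrite sqmod_eq0 (circle_multiplier_neq0 cb) ?z1.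
have [c [s [c0 s1 cs]]] := fejer_riesz sq qpos.
pose h z : R[i] := \prod_(al <- s) (1 - (al^*)%C * z).
have ch : circle_multiplier h.
  (* Membership in [s] is recorded in the product, because [|al| < 1] is known only for elements of
     [s]. *)
  rewrite /h; under eq_fun do rewrite big_seq_cond.
  apply: circle_multiplier_prod => al /andP[als _].
  exact/circle_multiplier_linear/s1.
(* A positive complex number is real, so [c] has a positive real square root, the scalar in front of
   [psi]. *)
have [r r0 cE] : exists2 r : R, 0 < r & c = (r ^+ 2)%:C.
  case: c c0 {cs} => x y; rewrite ltcE /= => /andP[/eqP -> x0].
  by exists (Num.sqrt x); rewrite ?sqrtr_gt0 // sqr_sqrtr // ltW.
exists (fun z => r%:C * h z / b z); split.
  apply: circle_multiplierM; last exact: circle_multiplierV.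
  apply: circle_multiplierM => //; apply: circle_multiplier_cst.
  by rewrite -sqmod_eq0 sqmod_real expf_eq0 /= gt_eqF.
move=> t; have z1 := norm_cis t.
have sb0 : sqmod (b (cis t)) != 0.
  by rewrite sqmod_eq0 (circle_multiplier_neq0 cb) ?z1.
rewrite !sqmodM sqmodV sqmod_real.
apply: (mulIf sb0); rewrite divfK // [RHS]mulrC.
apply: (@complexI R); rewrite -[RHS](qE _ z1) cs // cE rmorphM /=.
by rewrite sqmodE.
Qed.

End SpectralFactor.

(** * Additivity of the inner product in the weight *)

Section HardyInnerProduct.
Local Open Scope complex_scope.
Variable R : realType.
Implicit Types (phi psi f g : R[i] -> R[i]).

(** Both sides are means of the same measurable function [F] against weights on the circle. The
    weighted-sum formula for integrals is applied to its real and imaginary parts. *)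
Lemma hardy2_ip_circle_multiplier_sum (I : finType) (c : I -> R)
    (k : I -> R[i] -> R[i]) psi f g :
  (forall i, circle_multiplier (k i)) -> circle_multiplier psi ->
  (forall t, sqmod (psi (cis t)) = \sum_i c i * sqmod (k i (cis t))) ->
  hardy2 f -> hardy2 g ->
  hardy2_ip (fun z => psi z * f z) (fun z => psi z * g z) =
  \sum_i (c i)%:C * hardy2_ip (fun z => k i z * f z) (fun z => k i z * g z).
Proof.
move=> ck cpsi psiE [fh _] [gh _].
have [mfr mfi] := measurable_boundary_value fh.
have [mgr mgi] := measurable_boundary_value gh.
pose F t := boundary_value f t * ((boundary_value g t)^*)%C.
have FRe t : complex.Re (F t) =
    complex.Re (boundary_value f t) * complex.Re (boundary_value g t) +
    complex.Im (boundary_value f t) * complex.Im (boundary_value g t).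
  rewrite /F; case: (boundary_value f t) (boundary_value g t) => [x y] [u v] /=.
  by rewrite mulrN opprK.
have FIm t : complex.Im (F t) =
    complex.Im (boundary_value f t) * complex.Re (boundary_value g t) -
    complex.Re (boundary_value f t) * complex.Im (boundary_value g t).
  rewrite /F; case: (boundary_value f t) (boundary_value g t) => [x y] [u v] /=.
  by rewrite mulrN addrC.
have mRe : measurable_fun setT (fun t => complex.Re (F t)).
  under eq_fun do rewrite FRe.
  by apply: measurable_funD; apply: measurable_funM.
have mIm : measurable_fun setT (fun t => complex.Im (F t)).
  under eq_fun do rewrite FIm.
  by apply: measurable_funB; apply: measurable_funM.
set D : set R := [set` `[0, 2 * pi]].
have key (G : R -> R) : measurable_fun setT G ->
    \int[lebesgue_measure]_(t in D) (sqmod (psi (cis t)) * G t) =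
    \sum_i c i * \int[lebesgue_measure]_(t in D) (sqmod (k i (cis t)) * G t).
  move=> mG.
  have mD : measurable D by exact: measurable_itv.
  have mGD : measurable_fun D G by exact: measurable_funTS.
  have := Rintegral_weighted_sum (@lebesgue_measure R) mD mGD
    (fun i => @measurable_circle _ _ D (ck i))
    (fun i => @positively_bounded_circle _ _ D (ck i))
    (@measurable_circle _ _ D cpsi) (@positively_bounded_circle _ _ D cpsi).
  by apply => t _; exact: psiE.
have meanE phi : circle_multiplier phi ->
    hardy2_ip (fun z => phi z * f z) (fun z => phi z * g z) =
    ((2 * pi)^-1 * \int[lebesgue_measure]_(t in D)
      (sqmod (phi (cis t)) * complex.Re (F t))) +i*
    ((2 * pi)^-1 * \int[lebesgue_measure]_(t in D)
      (sqmod (phi (cis t)) * complex.Im (F t))).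
  move=> cphi; rewrite hardy2_ip_circle_multiplier // /circle_mean.
  congr (_ * _ +i* (_ * _)); apply: eq_Rintegral => t _; rewrite -/(F t);
    by case: (F t) => x y /=; ring.
rewrite (eq_bigr _ (fun i _ => congr1 (fun u => _ * u) (meanE _ (ck i)))).
rewrite meanE // !key // !mulr_sumr.
apply/eqP; rewrite eq_complex !raddf_sum; apply/andP; split; apply/eqP;
  apply: eq_bigr => i _ /=; ring.
Qed.

End HardyInnerProduct.

(** * The inner product identity and the normalization of [psi] *)

Theorem lemma41 (R : realType) :
  invertible_multiplier_property (@unit_disk R) (@hardy2 R) (@hardy2_ip R)
    (@szego_normalized R).
Proof.
move=> M a theta _ a1 th0 th1.
have [psi [cpsi psiE]] := spectral_factor a1 th0 th1.
have ck := circle_multiplier_kernel_family a1.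
have ipE f g (Hf : hardy2 f) (Hg : hardy2 g) :=
  hardy2_ip_circle_multiplier_sum ck cpsi psiE Hf Hg.
exists psi; split; last first.
  move=> f g Hf Hg; apply: etrans (esym (ipE f g Hf Hg)).
  (* Index [ord0] carries the constant 1 and yields the [theta ord0] term; the lifted indices yield
     the kernel terms. *)
  have k0 h : (fun z => kernel_family a ord0 z * h z) = h.
    by apply/funext => z; rewrite kernel_family0 mul1r.
  have kl m h : (fun z => kernel_family a (lift ord0 m) z * h z) =
      (fun z => szego_normalized (a m) z * h z).
    by apply/funext => z; rewrite kernel_family_lift.
  rewrite big_ord_recl.
  have -> : hardy2_ip (fun z => kernel_family a ord0 z * f z)
      (fun z => kernel_family a ord0 z * g z) = hardy2_ip f g.
    exact: congr2 (k0 f) (k0 g).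
  apply: (congr1 (fun u => _ + u)); apply: eq_bigr => m _.
  apply: (congr1 (fun u => _ * u)).
  by rewrite -(kl m f) -(kl m g).
(* Applied to the constant 1, the multiplier property gives membership of [psi], and the inner
   product identity gives its norm. *)
have psi1 : psi = (fun z => psi z * 1) by apply/funext => z; rewrite mulr1.
split.
- by move=> z z1; apply: circle_multiplier_neq0 cpsi _; exact: ltW.
- exact: circle_multiplier_hardy2.
- exact/circle_multiplier_hardy2/circle_multiplierV.
- by rewrite psi1; apply: circle_multiplier_hardy2 => //; exact: hardy2_1.
have pi0 : 2 * pi != 0 :> R by rewrite mulf_neq0 // gt_eqF // pi_gt0.
(* Every member of the family has norm 1, so the squared norm of [psi] is the sum of the
   [theta i]. *)
have ip1 i : hardy2_ip (fun z => kernel_family a i z * 1)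
    (fun z => kernel_family a i z * 1) = 1.
  transitivity (circle_mean
      (fun t : R => (sqmod (kernel_family a i (cis t)))%:C%C)).
    rewrite hardy2_ip_circle_multiplier //; congr circle_mean.
    by apply/funext => t; rewrite boundary_value_cst rmorph1 !mulr1.
  rewrite /circle_mean.
  (* The weight is real, so the imaginary part of the mean is the integral of 0. *)
  rewrite /= Rintegral_cst // mul0r mulr0.
  suff -> : \int[lebesgue_measure]_(t in `[0, 2 * pi])
      sqmod (kernel_family a i (cis t)) = 2 * pi by rewrite mulVf.
  have [->|[m ->]] : i = ord0 \/ exists m, i = lift ord0 m.
    by case: (unliftP ord0 i) => [m ->|->]; [right; exists m|left].
  - under eq_Rintegral do rewrite kernel_family0 sqmod_real expr1n.
    rewrite Rintegral_cst //= mul1r lebesgue_measure_itv /= lte_fin.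
    by rewrite mulr_gt0 ?pi_gt0 //= subr0.
  - apply: etrans (poisson_integral (a1 m)); apply: eq_Rintegral => t _.
    by rewrite kernel_family_lift (sqmod_szego _ (a1 m)).
rewrite /ip_norm {1 2}psi1 ipE; [|exact: hardy2_1|exact: hardy2_1].
under eq_bigr do rewrite ip1 mulr1.
by rewrite -rmorph_sum th1 sqrtr1.
Qed.
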